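(* There exists a universal constant $C>0$ such that for every discount factor $\gamma\in(0,1)$ and every $\epsilon>0$ there exist a Markov Decision Process $\mathcal{M}_0=(\mathcal{S},\mathcal{A},P,C_0,\gamma)$ with an initial state distribution $v$, and an oracle $\hat{V}^e:\mathcal{S}\to\mathbb{R}$ satisfying $$|\hat{V}^e(s)-V^*_{\mathcal{M}_0}(s)|=\epsilon\quad\text{for all } s\in\mathcal{S},$$ such that the policy $\hat{\pi}^*$ induced by the oracle, i.e. the (any) policy with $$\hat{\pi}^*(s)\in\arg\min_{a\in\mathcal{A}}\Big[\bar c(s,a)+\gamma\,\mathbb{E}_{s'\sim P_{sa}}[\hat{V}^e(s')]\Big]\quad\text{for all } s\in\mathcal{S},$$ satisfies $$J(\hat{\pi}^* )-J(\pi^* )\;\geq\; C\,\frac{\gamma}{1-\gamma}\,\epsilon,$$ where $\pi^*$ is an optimal policy of $\mathcal{M}_0$. (That is, $J(\hat\pi^* )-J(\pi^* )\ge\Omega\big(\tfrac{\gamma}{1-\gamma}\epsilon\big)$.)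
   Context: A (discounted, infinite-horizon, cost-based) Markov Decision Process is $\mathcal{M}_0=(\mathcal{S},\mathcal{A},P,C_0,\gamma)$, where $\mathcal{S}$ is a discrete (finite or countably infinite) set of states, $\mathcal{A}$ is a finite set of actions, $P(s'|s,a)$ is the probability of transitioning to $s'$ from $s$ under action $a$ (write $P_{sa}=P(\cdot|s,a)$), the cost $c(s,a)$ is sampled from a distribution $C_0(s,a)$ with mean $\bar c(s,a)$, where $\bar c$ is bounded, and $\gamma\in(0,1)$ is the discount factor. A stationary stochastic policy $\pi(a|s)$ gives the probability of choosing action $a$ at state $s$; deterministic policies are written $\pi(s)$. The value function (expected discounted total cost) of $\pi$ is $V^{\pi}_{\mathcal{M}_0}(s)=\mathbb{E}\big[\sum_{t=0}^{\infty}\gamma^t c(s_t,a_t)\,\big|\,s_0=s,\ a_t\sim\pi(\cdot|s_t),\ s_{t+1}\sim P_{s_ta_t}\big]$. An optimal policy $\pi^*$ is one minimizing $V^{\pi}_{\mathcal{M}_0}(s)$ over $\pi$ simultaneously for all $s\in\mathcal{S}$, and $V^*_{\mathcal{M}_0}=V^{\pi^*}_{\mathcal{M}_0}$. For an initial state distribution $v$ on $\mathcal{S}$, the performance of $\pi$ is $J(\pi)=\mathbb{E}_{s_0\sim v}[V^{\pi}_{\mathcal{M}_0}(s_0)]$. *)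

(* Defs.v *)
From HB Require Import structures.
From mathcomp Require Import all_boot all_order all_algebra.
From mathcomp Require Import all_classical all_reals all_analysis.

Set Implicit Arguments.
Unset Strict Implicit.
Unset Printing Implicit Defensive.

Import Order.TTheory GRing.Theory Num.Theory numFieldNormedType.Exports.

Local Open Scope classical_set_scope.
Local Open Scope ring_scope.

(* The state space is countable and carries the discrete sigma-algebra, so that
   laws on states are bona fide [probability]s and expectations over the next
   state are Lebesgue integrals. *)
Record mdp (R : realType) := MDP {
  state_disp : measure_display;
  state : measurableType state_disp;
  state_countable : countable [set: state];
  state_discrete : forall D : set state, measurable D;
  action : finType;
  trans : state -> action -> probability state R;
  cost : state -> action -> probability (measurableTypeR R) R;
  cost_integrable : forall s a,
    (cost s a).-integrable [set: R] (fun x : R => x%:E);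
  cost_mean_bounded : exists B : R, forall s a,
    `|Rintegral (cost s a) [set: R] (fun x : R => x)| <= B;
  discount : R;
  discount_gt0 : 0 < discount;
  discount_lt1 : discount < 1
}.

Definition mean_cost (R : realType) (M : mdp R) (s : state M) (a : action M) : R :=
  Rintegral (cost s a) [set: R] (fun x : R => x).

Record policy (R : realType) (M : mdp R) := Policy {
  policy_prob :> state M -> action M -> R;
  policy_ge0 : forall s a, 0 <= policy_prob s a;
  policy_sum1 : forall s, \sum_(a : action M) policy_prob s a = 1
}.

Section deterministic.
Context (R : realType) (M : mdp R) (f : state M -> action M).

Definition det_prob (s : state M) (a : action M) : R := (a == f s)%:R.

Lemma det_prob_ge0 s a : 0 <= det_prob s a.
Proof. exact: ler0n. Qed.

Lemma det_prob_sum1 s : \sum_(a : action M) det_prob s a = 1.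
Proof.
rewrite (bigD1 (f s)) //= /det_prob eqxx big1 ?addr0 // => a /negbTE ->.
by [].
Qed.

Definition det_policy : policy M := Policy det_prob_ge0 det_prob_sum1.

End deterministic.

(* A realization, on some probability space, of the controlled process
   s_0 = s0, a_t ~ pi(.|s_t), c_t ~ C_0(s_t, a_t), s_(t+1) ~ P(.|s_t, a_t).
   The finite-dimensional laws in [traj_law] determine the joint law of
   (s_t, a_t, c_t)_t; a realization always exists (Ionescu-Tulcea). *)
Record trajectory (R : realType) (M : mdp R) (pi : policy M) (s0 : state M) :=
  Trajectory {
  traj_disp : measure_display;
  traj_space : measurableType traj_disp;
  traj_prob : probability traj_space R;
  traj_state : nat -> traj_space -> state M;
  traj_action : nat -> traj_space -> action M;
  traj_cost : nat -> traj_space -> R;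
  traj_state_meas : forall t, measurable_fun [set: traj_space] (traj_state t);
  traj_action_meas : forall t a, measurable [set w | traj_action t w = a];
  traj_cost_meas : forall t, measurable_fun [set: traj_space] (traj_cost t);
  traj_law : forall (n : nat) (s : nat -> state M) (a : nat -> action M)
      (B : nat -> set R), (forall t, measurable (B t)) ->
    traj_prob [set w | forall t, (t <= n)%N ->
      [/\ traj_state t w = s t, traj_action t w = a t & B t (traj_cost t w)]] =
    (\d_s0 [set s 0%N] *
     \big[mule/1]_(t < n.+1) ((pi (s t) (a t))%:E * cost (s t) (a t) (B t)) *
     \big[mule/1]_(t < n) trans (s t) (a t) [set s t.+1])%E
}.

Arguments traj_disp {R M pi s0} tau : rename.
Arguments traj_space {R M pi s0} tau : rename.
Arguments traj_prob {R M pi s0} tau : rename.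
Arguments traj_state {R M pi s0} tau t w : rename.
Arguments traj_action {R M pi s0} tau t w : rename.
Arguments traj_cost {R M pi s0} tau t w : rename.

Section value.
Context (R : realType) (M : mdp R).

Definition discounted_cost (pi : policy M) (s : state M)
    (tau : trajectory pi s) (w : traj_space tau) : R :=
  limn (series (fun t => discount M ^+ t * traj_cost tau t w)).

(* All realizations have the same law, so the set below is a singleton and
   [value] does not depend on the one that is picked. *)
Definition value (pi : policy M) (s : state M) : \bar R :=
  get [set x | exists tau : trajectory pi s,
    x = ('E_(traj_prob tau)[discounted_cost (tau := tau)])%E].

(* E [sum_t gamma^t |c_t|] < +oo: the discounted series converges absolutely
   almost surely, to an integrable sum. Boundedness of the mean costs alone does
   not imply this. *)
Definition values_well_defined : Prop :=
  forall (pi : policy M) (s : state M) (tau : trajectory pi s),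
    (\int[traj_prob tau]_w
       \sum_(0 <= t <oo) (discount M ^+ t * `|traj_cost tau t w|)%:E < +oo)%E.

Definition optimal (pistar : policy M) : Prop :=
  forall (pi : policy M) (s : state M), (value pistar s <= value pi s)%E.

Definition performance (v : probability (state M) R) (pi : policy M) : \bar R :=
  (\int[v]_s value pi s)%E.

Definition lookahead (Vhat : state M -> R) (s : state M) (a : action M) : \bar R :=
  ((mean_cost s a)%:E + (discount M)%:E * \int[trans s a]_s' (Vhat s')%:E)%E.

Definition greedy (Vhat : state M -> R) (f : state M -> action M) : Prop :=
  forall (s : state M) (a : action M),
    (lookahead Vhat s (f s) <= lookahead Vhat s a)%E.

End value.

(* Main.v *)
(* On two states {true, false} let the action [true] taken in the state [true]
   stay there at cost [gamma * eps], while everything else leads to the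
   absorbing state [false] for free.  Leaving at once is optimal, so V* = 0.
   The oracle -eps at [true], +eps at [false] makes staying look worth
   gamma eps - gamma eps = 0 and leaving look worth gamma eps, so the greedy
   policy stays forever and pays gamma eps / (1 - gamma). *)
Require Import Defs.
From mathcomp Require Import all_boot all_order all_algebra.
From mathcomp Require Import all_classical all_reals all_analysis.
From mathcomp Require Import measurable_realfun.

Import Order.TTheory GRing.Theory Num.Theory numFieldNormedType.Exports.
Import HBNNSimple.

Local Open Scope classical_set_scope.
Local Open Scope ring_scope.

(** * Integrals of arbitrary functions modulo null sets *)

Section ae_integral_nonmeasurable.
Context d (T : measurableType d) (R : realType) (mu : measure T R).
Local Open Scope ereal_scope.

(* Monotonicity for arbitrary functions: a simple function below [f] is cut off
   on the null set to stay below [g].  The discounted cost, a limit that takes a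
   junk value where the series diverges, is thus never shown measurable. *)
Lemma ae_le_integral_nonmeasurable (f g : T -> \bar R) :
  (forall x, 0 <= f x) -> (forall x, 0 <= g x) ->
  (\forall x \ae mu, f x <= g x) -> \int[mu]_x f x <= \int[mu]_x g x.
Proof.
move=> f0 g0 [N [mN muN fgN]].
rewrite (ge0_integralTE mu f0) (ge0_integralTE mu g0).
apply: ge_ereal_sup => _ [h hf <-].
have mNC : measurable (~` N) by exact: measurableC.
pose h' := mul_nnsfun h (indic_nnsfun R mNC).
have h'E x : (h' x = h x * (x \in ~` N)%:R)%R by rewrite -indicE.
suff -> : sintegral mu h = sintegral mu h'.
  apply: ereal_sup_ubound; exists h' => // x.
  rewrite h'E; case: (boolP (x \in ~` N)) => [/set_mem xN|_] /=.
    rewrite mulr1; apply: le_trans (hf x) _.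
    by apply: contrapT => /fgN.
  by rewrite mulr0; exact: g0.
(* Both integrands are now simple, hence measurable, so the usual almost-everywhere comparison
   applies. *)
rewrite -!integralT_nnsfun; apply: ge0_ae_eq_integral => //.
- exact/measurable_EFinP.
- exact/measurable_EFinP.
- by move=> x _; rewrite lee_fin.
- by move=> x _; rewrite lee_fin.
exists N; split=> // x hx; apply: contrapT => xN; apply: hx => _.
by rewrite h'E mem_set // mulr1.
Qed.

(** Positive and negative parts are compared separately, by monotonicity in both directions. *)
Lemma ae_eq_integral_nonmeasurable (f g : T -> \bar R) :
  (\forall x \ae mu, f x = g x) -> \int[mu]_x f x = \int[mu]_x g x.
Proof.
move=> fg; rewrite integralE [RHS]integralE.
by congr (_ - _); apply/eqP; rewrite eq_le; apply/andP; split;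
  apply: ae_le_integral_nonmeasurable => // ; apply: filterS fg => x fgx;
  rewrite ?funeposE ?funenegE fgx.
Qed.

End ae_integral_nonmeasurable.

Lemma integral_cst_probability d (T : measurableType d) (R : realType)
  (P : probability T R) (r : \bar R) : (\int[P]_w r = r)%E.
Proof.
transitivity (r * P setT)%E; first exact: integral_cst.
by rewrite probability_setT mule1.
Qed.

(** Path laws are products; this reads off, from a path of nonzero mass, that the factor at each
    time is nonzero. *)
Lemma mule_big_neq0 (R : realDomainType) (I : finType) (F : I -> \bar R) (i : I) :
  \big[mule/1%E]_j F j <> 0%E -> F i <> 0%E.
Proof. by move=> + Fi0; apply; rewrite (bigD1 i) //= Fi0 mul0e. Qed.

(** * The two-state process and its deterministic costs *)

Section two_state.
Context (R : realType) (gamma eps : R).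
Hypotheses (gamma_gt0 : 0 < gamma) (gamma_lt1 : gamma < 1) (eps_gt0 : 0 < eps).

Definition step (s a : bool) : bool := s && a.
Definition stage_cost (s a : bool) : R := if step s a then gamma * eps else 0.

Lemma stage_cost_bounds s a : 0 <= stage_cost s a <= gamma * eps.
Proof.
have ge0 : 0 <= gamma * eps by rewrite mulr_ge0 ?ltW.
by rewrite /stage_cost; case: ifP => _; rewrite ge0 lexx.
Qed.

Definition sure_cost (x : R) : probability (measurableTypeR R) R :=
  @dirac _ (measurableTypeR R) x R.

Lemma sure_cost_integrable (x : R) :
  (sure_cost x).-integrable [set: R]
    (fun y : R => y%:E).
Proof.
apply/integrableP; split; first exact/measurable_EFinP.
rewrite integral_dirac //=; last first.
  by apply: measurableT_comp => //; exact/measurable_EFinP.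
by rewrite diracT mul1e ltry.
Qed.

Lemma sure_cost_mean (x : R) :
  Rintegral (sure_cost x) [set: R] (fun y : R => y)
  = x.
Proof.
rewrite /Rintegral integral_dirac //; first by rewrite diracT mul1e.
Qed.

Lemma stage_cost_mean_bounded : exists B : R, forall s a : bool,
  `|Rintegral (sure_cost (stage_cost s a))
      [set: R] (fun x : R => x)| <= B.
Proof.
exists (gamma * eps) => s a; rewrite sure_cost_mean.
by have /andP[c0 c1] := stage_cost_bounds s a; rewrite ger0_norm.
Qed.

Definition two_state : mdp R :=
  @MDP R _ (bool : measurableType _) (countableP _) (fun=> I) bool
    (fun s a => \d_(step s a)) (fun s a => sure_cost (stage_cost s a))
    (fun s a => sure_cost_integrable (stage_cost s a)) stage_cost_mean_bounded
    gamma gamma_gt0 gamma_lt1.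

(** * Almost sure dynamics of an arbitrary realization *)

Section two_state_trajectory.
Context (pi : policy two_state) (s0 : state two_state)
  (tau : trajectory pi s0).

(** Since [value] picks an unspecified realization, the finite-dimensional laws are turned here into
    pathwise identities valid for all of them. *)
Lemma traj_follows_dynamics : \forall w \ae traj_prob tau, forall n,
  [/\ traj_state tau 0 w = s0,
      pi (traj_state tau n w) (traj_action tau n w) <> 0,
      traj_state tau n.+1 w = step (traj_state tau n w) (traj_action tau n w) &
      traj_cost tau n w =
        stage_cost (traj_state tau n w) (traj_action tau n w)].
Proof.
(* Over the countably many paths [p] of length [n + 2], the events [F p] cover
   the failures at time [n], and each has a law with a vanishing factor. *)
apply: ae_foralln => n.
pose st (p : seq (bool * bool)) t : state two_state :=
  (nth (false, false) p t).1.
pose ac (p : seq (bool * bool)) t : action two_state :=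
  (nth (false, false) p t).2.
pose good p := [/\ st p 0 = s0, pi (st p n) (ac p n) <> 0 &
  st p n.+1 = step (st p n) (ac p n)].
(* On a good path the right cost at time [n] is excluded, so the Dirac cost factor vanishes; on any
   other path the initial, policy or transition factor already does. *)
pose B p t : set R := if `[< good p >] && (t == n)
  then ~` [set stage_cost (st p n) (ac p n)] else setT.
have mB p t : measurable (B p t).
  by rewrite /B; case: ifP => // _; exact: measurableC.
(* The horizon is [n.+1] so that the law contains the transition out of time [n]. *)
pose F p := [set w | forall t, (t <= n.+1)%N ->
  [/\ traj_state tau t w = st p t, traj_action tau t w = ac p t &
      B p t (traj_cost tau t w)]].
have F0 p : (traj_prob tau).-negligible (F p).
  exists (F p); split=> //.
    rewrite [F p](_ : _ = \bigcap_(t in [set t | (t <= n.+1)%N])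
      ((traj_state tau t @^-1` [set st p t]) `&`
       [set w | traj_action tau t w = ac p t] `&`
       (traj_cost tau t @^-1` B p t))); last first.
      by apply/seteqP; split=> w /= Fw t /Fw; [case | case=> -[]].
    apply: bigcap_measurableType => t _; apply: measurableI.
      apply: measurableI; last exact: traj_action_meas.
      by rewrite -[X in measurable X]setTI; exact: traj_state_meas.
    by rewrite -[X in measurable X]setTI; exact: traj_cost_meas.
  rewrite traj_law //; apply/eqP; apply: contrapT => /negP.
  rewrite !mule_eq0 !negb_or => /andP[/andP[/eqP d0 /eqP pc0] /eqP tr0].
  have n_lt : (n < n.+2)%N by exact: ltnW.
  have := mule_big_neq0 _ _ _ (Ordinal n_lt) pc0.
  move=> /eqP; rewrite mule_eq0 negb_or /= => /andP[/eqP pi0 /eqP c0].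
  have := mule_big_neq0 _ _ _ (Ordinal (ltnSn n)) tr0.
  move: d0 c0; rewrite /= /dirac !indicE => d0 c0 t0.
  have Gp : good p.
    split.
    - by apply: contrapT => H; apply: d0; rewrite memNset //= => E; exact: H.
    - by move=> H; apply: pi0; rewrite H.
    - by apply: contrapT => H; apply: t0; rewrite memNset //= => E; exact: H.
  by apply: c0; rewrite memNset // /B asboolT //= eqxx /=; apply.
(* Codes of no path default to [[::]], which only repeats a null set in the union. *)
have nF : (traj_prob tau).-negligible
    (\bigcup_k F (odflt [::] (unpickle k))).
  by apply: negligible_bigcup => k; exact: F0.
apply: negligibleS nF.
move=> w bad.
pose p : seq (bool * bool) :=
  mkseq (fun t => (traj_state tau t w, traj_action tau t w)) n.+2.
exists (pickle p) => //.
have -> : odflt [::] (unpickle (pickle p)) = p by rewrite pickleK.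
move=> t tn.
have stE u : (u <= n.+1)%N -> st p u = traj_state tau u w.
  by move=> un; rewrite /st nth_mkseq.
have acE u : (u <= n.+1)%N -> ac p u = traj_action tau u w.
  by move=> un; rewrite /ac nth_mkseq.
rewrite stE // acE //; split=> //.
(* If the path of [w] is good, its failure at time [n] can only lie in the cost. *)
rewrite /B; case: ifP => // /andP[/asboolP + /eqP tE] /=.
rewrite /good !(stE, acE) // tE => -[g1 g2 g3] gc.
exact: bad.
Qed.

End two_state_trajectory.

Arguments traj_follows_dynamics {p s} tau : rename.

(** * Finiteness and nonnegativity of the values of all policies *)

Lemma geometric_cost_cvg : cvgn (series (geometric (gamma * eps) gamma)).
Proof. by apply: is_cvg_geometric_series; rewrite ger0_norm // ltW. Qed.

(** Almost every path has its discounted series dominated by a geometric one, whose sum is a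
    constant and so integrable. *)
Lemma two_state_values_well_defined : values_well_defined two_state.
Proof.
move=> pi s0 tau.
apply: (@le_lt_trans _ _
  (\int[traj_prob tau]_w ((gamma * eps / (1 - gamma))%:E))%E).
  apply: ae_le_integral_nonmeasurable.
  - move=> w; apply: nneseries_ge0 => t _ _.
    by rewrite lee_fin mulr_ge0 // exprn_ge0 // ltW.
  - move=> w; rewrite lee_fin divr_ge0 ?mulr_ge0 ?subr_ge0 ?ltW //.
  apply: filterS (traj_follows_dynamics tau) => w Hw.
  apply: lime_le.
    apply: is_cvg_nneseries => t _ _.
    by rewrite lee_fin mulr_ge0 // exprn_ge0 // ltW.
  apply: nearW => n.
  apply: (@le_trans _ _ (series (geometric (gamma * eps) gamma) n)%:E).
    rewrite /series /= -sumEFin; apply: lee_sum => t _.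
    rewrite lee_fin mulrC; have [_ _ _ ->] := Hw t.
    have /andP[c0 c1] := stage_cost_bounds (traj_state tau t w)
      (traj_action tau t w).
    by rewrite ger0_norm // ler_wpM2r // exprn_ge0 // ltW.
  by rewrite lee_fin geometric_le_lim ?mulr_ge0 ?ger0_norm ?ltW.
by rewrite integral_cst_probability; exact: ltry.
Qed.

(** Costs are almost surely nonnegative under any stochastic policy; a policy of value zero is
    therefore optimal. *)
Lemma two_state_value_ge0 (pi : policy two_state) (s : state two_state) :
  (0 <= value pi s)%E.
Proof.
rewrite /value; set V := (X in get X).
(* [V] is never empty; the empty case is not excluded here, as then
   [get V = point = 0]. *)
have [[x Vx]|V0] := pselect (exists x, V x); last first.
  by rewrite getPN // => x Vx; apply: V0; exists x.
have [tau ->] : V (get V) by apply: getPex; exists x.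
rewrite unlock.
(* The sum is nonnegative only almost surely; its maximum with 0 is so everywhere and has the same
   integral. *)
rewrite (@ae_eq_integral_nonmeasurable _ _ _ _ _
  (fun w => (Num.max (discounted_cost (tau := tau) w) 0)%:E)).
  by apply: integral_ge0 => w _; rewrite lee_fin le_max lexx orbT.
apply: filterS (traj_follows_dynamics tau) => w Hw.
congr (_%:E); apply/esym/max_idPl.
rewrite /discounted_cost.
have u0 t : 0 <= gamma ^+ t * traj_cost tau t w.
  have [_ _ _ ->] := Hw t; apply: mulr_ge0; first by rewrite exprn_ge0 // ltW.
  by case/andP: (stage_cost_bounds (traj_state tau t w) (traj_action tau t w)).
apply: limr_ge; last by apply: nearW => n; exact: sumr_ge0.
apply: (series_le_cvg u0 _ _ geometric_cost_cvg) => t /=.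
  by rewrite !mulr_ge0 ?exprn_ge0 // ltW.
have [_ _ _ ->] := Hw t.
have /andP[_ c1] := stage_cost_bounds (traj_state tau t w)
      (traj_action tau t w).
by rewrite mulrC ler_wpM2r // exprn_ge0 // ltW.
Qed.

(** * Values of deterministic policies *)

Section deterministic_policy.
Context (f : state two_state -> action two_state) (s0 : state two_state).

Definition det_state (t : nat) : state two_state :=
  iter t (fun s : bool => step s (f s)) s0.

(** Both sides are 0 or 1: along the deterministic path every factor is 1, and a nonzero product
    forces the prescribed path to be that one, by induction on time. *)
Lemma det_traj_law (n : nat) (s : nat -> state two_state)
    (a : nat -> action two_state) (B : nat -> set R) :
  (forall t, measurable (B t)) ->
  (\d_tt : probability unit R) [set w : unit | forall t, (t <= n)%N ->
      [/\ det_state t = s t, f (det_state t) = a t &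
          B t (stage_cost (det_state t) (f (det_state t)))]] =
    (\d_s0 [set s 0%N] *
     \big[mule/1]_(t < n.+1) ((det_policy f (s t) (a t))%:E *
                              cost (s t) (a t) (B t)) *
     \big[mule/1]_(t < n) trans (s t) (a t) [set s t.+1])%E.
Proof.
move=> mB; have [H|H] := pselect (forall t, (t <= n)%N ->
      [/\ det_state t = s t, f (det_state t) = a t &
          B t (stage_cost (det_state t) (f (det_state t)))]).
  rewrite [LHS]diracE mem_set //.
  have [H0 _ _] := H 0%N isT.
  rewrite diracE mem_set //= mul1e !big1 ?mule1 // => t _.
    have [st at_ _] := H t (ltnW (ltn_ord t)).
    have [st1 _ _] := H t.+1 (ltn_ord t).
    by rewrite /dirac indicE mem_set //= -st1 -at_ -st.
  have [st at_ Bt] := H t (ltn_ord t).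
  rewrite /det_prob -at_ -st eqxx mul1e /dirac indicE mem_set //.
rewrite [LHS]diracE memNset //=.
apply/esym/eqP; apply: contrapT => /negP.
rewrite !mule_eq0 !negb_or => /andP[/andP[/eqP d0 /eqP pc0] /eqP tr0].
have s0E : det_state 0 = s 0%N.
  by apply: contrapT => E; apply: d0; rewrite diracE memNset.
have step_a t : (t <= n)%N -> a t = f (s t) /\ B t (stage_cost (s t) (a t)).
  move=> tn; have := mule_big_neq0 _ _ _ (Ordinal (tn : (t < n.+1)%N)) pc0.
  move=> /eqP; rewrite mule_eq0 negb_or /= => /andP[pi0 /eqP c0]; split.
    by apply/eqP; apply: contraNT pi0; rewrite /det_prob => /negbTE ->.
  by apply: contrapT => E; apply: c0; rewrite /dirac indicE memNset.
have step_s t : (t < n)%N -> s t.+1 = step (s t) (a t).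
  move=> tn; have /= t0 := mule_big_neq0 _ _ _ (Ordinal tn) tr0.
  by apply: contrapT => E; apply: t0; rewrite /dirac indicE memNset // => /= /esym.
have sE t : (t <= n)%N -> det_state t = s t.
  elim: t => [//|t IH tn]; rewrite step_s // /det_state iterS.
  by have [-> _] := step_a _ (ltnW tn); rewrite -IH // ltnW.
apply: H => t tn; have [aE Bt] := step_a t tn.
by rewrite sE // -aE.
Qed.

(** With neither policy nor dynamics random, a one-point sample space suffices. This realization
    shows that the [get] in [value] is not a default. *)
Definition det_trajectory : trajectory (det_policy f) s0 :=
  @Trajectory R two_state (det_policy f) s0 _ (unit : measurableType _) \d_tt
    (fun t _ => det_state t) (fun t _ => f (det_state t))
    (fun t _ => stage_cost (det_state t) (f (det_state t)))
    (fun=> measurable_cst _) (fun _ _ => I) (fun=> measurable_cst _)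
    det_traj_law.

(** The realization behind [get] may differ from [det_trajectory], but in each one the discounted
    cost is almost surely this same constant. *)
Lemma det_policy_value :
  value (det_policy f) s0 = (limn (series (fun t =>
    gamma ^+ t * stage_cost (det_state t) (f (det_state t)))))%:E.
Proof.
rewrite /value; set V := [set _ | _].
have [tau ->] : V (get V).
  by apply: getPex; eexists; exists det_trajectory; reflexivity.
rewrite unlock (@ae_eq_integral_nonmeasurable _ _ _ _ _ (fun=> (limn (series
  (fun t => gamma ^+ t * stage_cost (det_state t) (f (det_state t)))))%:E)).
  by rewrite integral_cst_probability.
apply: filterS (traj_follows_dynamics tau) => w Hw.
have aE t : traj_action tau t w = f (traj_state tau t w).
  have [_ + _ _] := Hw t; rewrite /= /det_prob.
  by case: eqP => // _; rewrite mulr0n.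
have sE t : traj_state tau t w = det_state t.
  elim: t => [|t IH]; first by have [-> _ _ _] := Hw 0%N.
  by have [_ _ -> _] := Hw t; rewrite aE IH.
congr (_%:E); rewrite /discounted_cost.
congr (limn (series _)); apply/funext => t.
by have [_ _ _ ->] := Hw t; rewrite aE sE.
Qed.

End deterministic_policy.

(** * The optimal policy, the skewed oracle and its greedy policies *)

Definition stay_away (s : state two_state) : action two_state := false.

Definition skewed_oracle (s : state two_state) : R := if s then - eps else eps.

Lemma stay_away_value s : value (det_policy stay_away) s = 0%E.
Proof.
rewrite det_policy_value (_ : (fun _ => _) = fun=> 0); last first.
  by apply/funext => t; rewrite /stage_cost /step andbF mulr0.
congr (_%:E); apply/cvg_lim => //.
rewrite (_ : series _ = fun=> 0); first exact: cvg_cst.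
by apply/funext => n; rewrite /series /= big1.
Qed.

(** Staying is strictly better in the lookahead, by [gamma * eps], so there is no tie at [true] and
    every greedy policy stays. *)
Lemma greedy_skewed_oracle pihat :
  greedy skewed_oracle pihat -> pihat true = true.
Proof.
move=> /(_ true true); case: (pihat true) => //.
rewrite /lookahead /mean_cost /= !sure_cost_mean !integral_dirac //=.
rewrite !diracT !mul1e /stage_cost /= -!EFinM -!EFinD lee_fin add0r.
by rewrite mulrN subrr leNgt mulr_gt0.
Qed.

Lemma greedy_value pihat : greedy skewed_oracle pihat ->
  value (det_policy pihat) true = (gamma * eps / (1 - gamma))%:E.
Proof.
move=> /greedy_skewed_oracle pihatT.
have stT t : det_state pihat true t = true.
  by elim: t => // t IH; rewrite /det_state iterS -/(det_state _ _ t) IH pihatT.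
rewrite det_policy_value; congr (_%:E); apply/cvg_lim => //.
rewrite (_ : (fun _ => _) = geometric (gamma * eps) gamma).
  by apply: cvg_geometric_series; rewrite ger0_norm // ltW.
by apply/funext => t; rewrite stT pihatT /stage_cost /= mulrC.
Qed.

Lemma performance_dirac (s : state two_state) (pi : policy two_state) :
  performance (\d_s) pi = value pi s.
Proof. by rewrite /performance integral_dirac // diracT mul1e. Qed.

End two_state.

Theorem theorem3p1 (R : realType) :
  exists C : R, 0 < C /\
  forall gamma eps : R, 0 < gamma -> gamma < 1 -> 0 < eps ->
  exists (M : mdp R) (v : probability (state M) R) (Vhat : state M -> R)
         (pistar : policy M),
    [/\ discount M = gamma,
        values_well_defined M,
        optimal pistar,
        (forall s : state M, `|(Vhat s)%:E - value pistar s| = eps%:E)%E &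
        forall pihat : state M -> action M, greedy Vhat pihat ->
          (performance v (det_policy pihat) - performance v pistar
             >= (C * (gamma / (1 - gamma)) * eps)%:E)%E].
Proof.
(* The loss equals [gamma * eps / (1 - gamma)] exactly, whence the constant 1. *)
exists 1; split=> // gamma eps gamma_gt0 gamma_lt1 eps_gt0.
pose M := two_state _ _ _ gamma_gt0 gamma_lt1 eps_gt0.
(* The start is at [true], the only state where the action changes the cost or the next state. *)
exists M, \d_(true : state M), (skewed_oracle _ _ _ gamma_gt0 gamma_lt1 eps_gt0).
exists (det_policy (stay_away _ _ _ gamma_gt0 gamma_lt1 eps_gt0)); split.
- by [].
- exact: two_state_values_well_defined.
- by move=> pi s; rewrite stay_away_value; exact: two_state_value_ge0.
- move=> s; rewrite stay_away_value sube0 abse_EFin /skewed_oracle.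
  by case: s; rewrite ?normrN gtr0_norm.
move=> pihat greedy_pihat.
rewrite !performance_dirac stay_away_value sube0 greedy_value //.
by rewrite lee_fin mul1r mulrAC.
Qed.
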